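(* Let $S$ be a finite semigroup. The quotient $S/\eta^{*}$ is in the pseudovariety $\mathbf{BG}_{nil}$.
   Context: For a semigroup $S$, $S^1$ denotes $S$ if $S$ has an identity, and $S$ with an identity $1$ adjoined otherwise. For $x,y,z_1,z_2,\ldots$ in $S^1$ define recursively $\lambda_0=x$, $\rho_0=y$, and $\lambda_{n+1}=\lambda_n z_{n+1}\rho_n$, $\rho_{n+1}=\rho_n z_{n+1}\lambda_n$, where $\lambda_n=\lambda_n(x,y,z_1,\ldots,z_n)$ and $\rho_n=\rho_n(x,y,z_1,\ldots,z_n)$. For a semigroup $S$ let $\eta_1=\{(x,x)\mid x\in S\}$ and, for every integer $n>1$, let $x\,\eta_n\,y$ if and only if there exist $z_1,\ldots,z_n\in S^1$ such that $x=\lambda_n(x,y,z_1,\ldots,z_n)$ and $y=\rho_n(x,y,z_1,\ldots,z_n)$. Let $\eta$ be the transitive closure of $\bigcup_{i\ge 1}\eta_i$, and let $\eta^{*}$ be the smallest congruence on $S$ containing $\eta$. A semigroup is a block group if each element $s$ has at most one inverse (an element $t$ with $sts=s$ and $tst=t$). $\mathbf{BG}_{nil}$ is the class (a pseudovariety) of all finite block groups all of whose subgroups are nilpotent groups. *)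

(* Defs.v *)
From HB Require Import structures.
From Stdlib Require Import Relation_Operators.
From mathcomp Require Import all_boot all_fingroup all_solvable.
From mathcomp Require Import boolp.
(* fingroup shadows [repr] *)
Import generic_quotient.

Set Implicit Arguments.
Unset Strict Implicit.
Unset Printing Implicit Defensive.

Local Open Scope quotient_scope.

(* MathComp's [semigroupType] cannot be used here: no join of [Semigroup] and
   [Finite] is declared below [FinGroup], and HB does not allow adding one
   afterwards.  The empty semigroup is not excluded. *)
HB.mixin Record isFinSemigroup S of Finite S := {
  smul : S -> S -> S;
  smulA : associative smul
}.

#[short(type="finSemigroupType")]
HB.structure Definition FinSemigroup := { S of isFinSemigroup S & Finite S }.

Declare Scope semigroup_scope.
Delimit Scope semigroup_scope with sg.
Infix "*" := smul : semigroup_scope.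
Local Open Scope semigroup_scope.

Section AdjoinOne.
Variable S : finSemigroupType.

Definition has_identity : bool :=
  [exists e : S, forall x : S, (e * x == x) && (x * e == x)].

(* [None] is the adjoined identity; it is allowed only when [S] has none. *)
Definition in_adjoin1 : pred (option S) :=
  fun u => if u is Some _ then true else ~~ has_identity.

Definition adjoin1 : Type := {u : option S | in_adjoin1 u}.

Definition omul (u v : option S) : option S :=
  match u, v with
  | None, _ => v
  | _, None => u
  | Some x, Some y => Some (x * y)
  end.

Lemma omul_adjoin1 (u v : adjoin1) : in_adjoin1 (omul (val u) (val v)).
Proof. by case: u v => [[x|] px] [[y|] py]. Qed.

Definition mul1 (u v : adjoin1) : adjoin1 :=
  exist _ (omul (val u) (val v)) (omul_adjoin1 u v).

Definition to1 (x : S) : adjoin1 := exist _ (Some x) isT.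

End AdjoinOne.

Section Eta.
Variable S : finSemigroupType.
Local Notation S1 := (adjoin1 S).
Local Notation "u ** v" := (mul1 u v) (at level 40, left associativity).

Definition lambda_rho_step (p : S1 * S1) (z : S1) : S1 * S1 :=
  (p.1 ** z ** p.2, p.2 ** z ** p.1).

(* [zs = [:: z_1; ...; z_n]]; the fold consumes [z_1] first. *)
Definition lambda (x y : S1) (zs : seq S1) : S1 :=
  (foldl lambda_rho_step (x, y) zs).1.
Definition rho (x y : S1) (zs : seq S1) : S1 :=
  (foldl lambda_rho_step (x, y) zs).2.

Lemma lambda0 x y : lambda x y [::] = x. Proof. by []. Qed.
Lemma rho0 x y : rho x y [::] = y. Proof. by []. Qed.
Lemma lambdaS x y zs z :
  lambda x y (rcons zs z) = lambda x y zs ** z ** rho x y zs.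
Proof. by rewrite /lambda foldl_rcons. Qed.
Lemma rhoS x y zs z :
  rho x y (rcons zs z) = rho x y zs ** z ** lambda x y zs.
Proof. by rewrite /rho foldl_rcons. Qed.

Definition eta_ (n : nat) (x y : S) : Prop :=
  (n = 1 /\ x = y) \/
  (1 < n /\ exists zs : n.-tuple S1,
     to1 x = lambda (to1 x) (to1 y) zs /\ to1 y = rho (to1 x) (to1 y) zs).

Definition eta : S -> S -> Prop :=
  clos_trans S (fun x y => exists2 n : nat, 1 <= n & eta_ n x y).

End Eta.

Section Congruences.
Variable S : finSemigroupType.

Record is_congruence (R : S -> S -> Prop) : Prop := IsCongruence {
  cong_refl : forall x, R x x;
  cong_sym : forall x y, R x y -> R y x;
  cong_trans : forall x y z, R x y -> R y z -> R x z;
  cong_mul : forall x x' y y', R x x' -> R y y' -> R (x * y) (x' * y')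
}.

Definition cong_closure (E : S -> S -> Prop) (x y : S) : Prop :=
  forall R : S -> S -> Prop,
    is_congruence R -> (forall u v, E u v -> R u v) -> R x y.

Lemma cong_closureP E : is_congruence (cong_closure E).
Proof.
split=> [x R cR _|x y xy R cR ER|x y z xy yz R cR ER|x x' y y' xx' yy' R cR ER].
- exact: cong_refl cR x.
- exact: cong_sym cR _ _ (xy R cR ER).
- exact: cong_trans cR _ _ _ (xy R cR ER) (yz R cR ER).
- exact: cong_mul cR _ _ _ _ (xx' R cR ER) (yy' R cR ER).
Qed.

Lemma sub_cong_closure E x y : E x y -> cong_closure E x y.
Proof. by move=> Exy R _; apply. Qed.

Section Quotient.
Variables (R : S -> S -> Prop) (congR : is_congruence R).

Definition cong_bool : rel S := fun x y => `[< R x y >].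

Lemma cong_bool_equiv : equiv_class_of cong_bool.
Proof.
split=> [x|x y|y x z].
- exact/asboolP/(cong_refl congR).
- by apply/asboolP/asboolP; apply: (cong_sym congR).
- by move=> /asboolP xy /asboolP yz; apply/asboolP/(cong_trans congR xy).
Qed.

Definition cong_equiv : equiv_rel S := EquivRelPack cong_bool_equiv.

Definition cong_quot : Type := {eq_quot cong_equiv}.

HB.instance Definition _ := EqQuotient.on cong_quot.
HB.instance Definition _ := Countable.on cong_quot.
HB.instance Definition _ :=
  Finite.copy cong_quot (can_type (@EquivQuot.ereprK S S id id _ cong_equiv)).

Definition cong_quot_mul (X Y : cong_quot) : cong_quot :=
  \pi_cong_quot (repr X * repr Y).

Lemma cong_quotP (x y : S) : \pi_cong_quot x = \pi_cong_quot y <-> R x y.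
Proof.
by split=> [/(@eqmodP S cong_equiv)/asboolP | /asboolP/(@eqmodP S cong_equiv)].
Qed.

Lemma cong_quot_mulE (x y : S) :
  cong_quot_mul (\pi_cong_quot x) (\pi_cong_quot y) = \pi_cong_quot (x * y).
Proof. by apply/cong_quotP/(cong_mul congR); apply/cong_quotP; rewrite reprK. Qed.

Lemma cong_quot_mulA : associative cong_quot_mul.
Proof.
elim/quotW=> x; elim/quotW=> y; elim/quotW=> z.
by rewrite (cong_quot_mulE y z) (cong_quot_mulE x y) !(cong_quot_mulE _ _) smulA.
Qed.

HB.instance Definition _ := isFinSemigroup.Build cong_quot cong_quot_mulA.

Definition quotient_semigroup : finSemigroupType := cong_quot.

End Quotient.

End Congruences.

Definition eta_star (S : finSemigroupType) : S -> S -> Prop :=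
  cong_closure (@eta S).

Definition eta_star_congruence (S : finSemigroupType) :
  is_congruence (@eta_star S) := cong_closureP (@eta S).

Section BlockGroups.
Variable T : finSemigroupType.

Definition is_inverse (s t : T) : Prop := s * t * s = s /\ t * s * t = t.

Definition block_group : Prop :=
  forall s t t' : T, is_inverse s t -> is_inverse s t' -> t = t'.

(* A subset of [T] that is a group under the multiplication of [T].  Its
   identity [sg1] is an arbitrary idempotent, not an identity of [T]; the
   values of [sgV] outside [sgset] are irrelevant. *)
Record subgroup := Subgroup {
  sgset : {set T};
  sg1 : T;
  sgV : T -> T;
  sg1_in : sg1 \in sgset;
  sgV_in : forall x, x \in sgset -> sgV x \in sgset;
  sgM_in : forall x y, x \in sgset -> y \in sgset -> x * y \in sgset;
  sg_mul1 : forall x, x \in sgset -> sg1 * x = x;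
  sg_mulV : forall x, x \in sgset -> sgV x * x = sg1
}.

Section SubgroupType.
Variable H : subgroup.

Definition subgroup_type : Type := {x : T | x \in sgset H}.

HB.instance Definition _ := Finite.on subgroup_type.

Definition sgt_one : subgroup_type := exist _ (sg1 H) (sg1_in H).
Definition sgt_inv (u : subgroup_type) : subgroup_type :=
  exist _ (sgV H (val u)) (sgV_in (valP u)).
Definition sgt_mul (u v : subgroup_type) : subgroup_type :=
  exist _ (val u * val v) (sgM_in (valP u) (valP v)).

Lemma sgt_mulA : associative sgt_mul.
Proof. by move=> u v w; apply: val_inj; rewrite /= smulA. Qed.
Lemma sgt_mul1 : left_id sgt_one sgt_mul.
Proof. by move=> u; apply: val_inj; rewrite /= sg_mul1 ?(valP u). Qed.
Lemma sgt_mulV : left_inverse sgt_one sgt_inv sgt_mul.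
Proof. by move=> u; apply: val_inj; rewrite /= sg_mulV ?(valP u). Qed.

HB.instance Definition _ :=
  Finite_isGroup.Build subgroup_type sgt_mulA sgt_mul1 sgt_mulV.

End SubgroupType.

Definition BGnil : Prop :=
  block_group /\ forall H : subgroup, nilpotent [set: subgroup_type H].

End BlockGroups.

(* Main.v *)
(** The quotient [T] is reduced in the following sense: whatever rule [z]
    selects the next letter from the current pair, iterating
    [(x, y) |-> (x z y, y z x)] from any pair of [T] reaches the diagonal.
    Indeed the iteration lifts to [S], where by finiteness it enters a cycle,
    and the entries of a pair on a cycle are eta-related.

    Two idempotents [e], [f] that are L- or R-related are fixed or swapped by
    the step with letter [e], hence equal; so inverses are unique.

    In a group, the step with letter [z] sends [x y^-1] to
    [a w a^-1 w^-1] where [a = x y^-1] and [w = y z] is arbitrary.  If the group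
    is not nilpotent, its upper central series stops at a proper subgroup [Z],
    and from [a] outside [Z] one can choose [w] such that this commutator is
    again outside [Z]; the iteration then never reaches the diagonal. *)

Require Import Defs.
From Stdlib Require Import Relation_Operators.
From mathcomp Require Import all_boot all_fingroup all_solvable.
From mathcomp Require Import boolp.
Import generic_quotient.

Set Implicit Arguments.
Unset Strict Implicit.
Unset Printing Implicit Defensive.

Local Open Scope quotient_scope.

(** The letter depends only on the current pair, so on a finite carrier the iteration is a self-map
    and becomes periodic. *)
Definition pair_step (T : Type) (mul : T -> T -> T) (z : T * T -> T)
    (p : T * T) : T * T :=
  (mul (mul p.1 (z p)) p.2, mul (mul p.2 (z p)) p.1).

Lemma iter_pair_step_morph (A B : Type) (mulA : A -> A -> A)
    (mulB : B -> B -> B) (h : A -> B) (zA : A * A -> A) (zB : B * B -> B) :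
  {morph h : x y / mulA x y >-> mulB x y} ->
  (forall x y, h (zA (x, y)) = zB (h x, h y)) ->
  forall k x y, let q := iter k (pair_step mulA zA) (x, y) in
  iter k (pair_step mulB zB) (h x, h y) = (h q.1, h q.2).
Proof.
move=> hM hz k x y /=; elim: k => //= k ->.
by case: (iter _ _ _) => u v; rewrite /pair_step /= !hM hz.
Qed.

Lemma iter_eventually_periodic (T : finType) (f : T -> T) (x : T) :
  exists k, exists2 m, 0 < m & iter m f (iter k f x) = iter k f x.
Proof.
have /trajectP [i lt_i eq_i] := looping_order f x.
exists i, (fingraph.order f x - i); first by rewrite subn_gt0.
by rewrite -iterD subnK // ltnW.
Qed.

Lemma mul1_to1 (S : finSemigroupType) (x y : S) :
  mul1 (to1 x) (to1 y) = to1 (smul x y).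
Proof. exact: val_inj. Qed.

(** The letters selected along the trajectory serve as the word on which [lambda] and [rho] are
    evaluated. *)
Lemma foldl_lambda_rho_step (S : finSemigroupType) (z : S * S -> S) n q :
  let r := iter n (pair_step (@smul S) z) q in
  foldl (@lambda_rho_step S) (to1 q.1, to1 q.2)
    [seq to1 (z p) | p <- traject (pair_step (@smul S) z) q n]
  = (to1 r.1, to1 r.2).
Proof.
elim: n q => //= n IHn q; rewrite /lambda_rho_step /= !mul1_to1.
by have /= -> := IHn (pair_step (@smul S) z q); rewrite -iterSr.
Qed.

Lemma iter_pair_step_eta (S : finSemigroupType) (z : S * S -> S) p :
  exists k, let q := iter k (pair_step (@smul S) z) p in eta q.1 q.2.
Proof.
have [k [m m_gt0 qE]] := iter_eventually_periodic (pair_step (@smul S) z) p.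
exists k; move: (iter k _ _) qE => q qE /=.
(* The cycle is traversed twice because [eta_] allows no single step. *)
apply: t_step; exists (m + m); first by rewrite addn_gt0 m_gt0.
right; split; first by rewrite -[1]/(0 + 1) -addSn leq_add.
set s := [seq to1 (z r) | r <- traject (pair_step (@smul S) z) q (m + m)].
have sz_s : size s == m + m by rewrite size_map size_traject.
exists (Tuple sz_s); rewrite /lambda /rho /=.
by rewrite foldl_lambda_rho_step iterD !qE.
Qed.

Definition reduced (T : finSemigroupType) : Prop :=
  forall (z : T * T -> T) p,
    exists k, let q := iter k (pair_step (@smul T) z) p in q.1 = q.2.

Lemma quotient_eta_star_reduced (S : finSemigroupType) :
  reduced (quotient_semigroup (eta_star_congruence S)).
Proof.
set T := quotient_semigroup _ => z p.
pose h (x : S) : T := \pi_(cong_quot (eta_star_congruence S)) x.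
pose g (x : T) : S := repr (x : cong_quot (eta_star_congruence S)).
have gK x : h (g x) = x by apply: reprK.
have hM : {morph h : x y / smul x y >-> smul x y}.
  by move=> x y; symmetry; apply: cong_quot_mulE.
(* The rule is pulled back along the section [g], so that [h] intertwines the two iterations. *)
pose zS (r : S * S) := g (z (h r.1, h r.2)).
have [k eta_q] := iter_pair_step_eta zS (g p.1, g p.2).
have hz x y : h (zS (x, y)) = z (h x, h y) by rewrite /zS gK.
have := iter_pair_step_morph hM hz k (g p.1) (g p.2).
rewrite !gK -surjective_pairing => /= qE.
exists k; rewrite /= qE.
apply: (proj2 (cong_quotP (eta_star_congruence S) _ _)).
exact: sub_cong_closure.
Qed.

Section ReducedBlockGroup.
Variable T : finSemigroupType.
Local Open Scope semigroup_scope.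

Lemma reduced_fix_or_swap (x y z : T) :
  reduced T ->
  (x * z * y = x /\ y * z * x = y) \/ (x * z * y = y /\ y * z * x = x) ->
  x = y.
Proof.
move=> redT fix_or_swap; have [k] := redT (fun=> z) (x, y).
have: iter k (pair_step (@smul T) (fun=> z)) (x, y) \in [:: (x, y); (y, x)].
  elim: k => [|k]; first by rewrite mem_head.
  rewrite iterS !inE; case: fix_or_swap => -[xE yE] /orP[] /eqP ->;
    by rewrite /pair_step /= xE yE eqxx ?orbT.
by rewrite !inE => /orP[] /eqP ->.
Qed.

Lemma reduced_block_group : reduced T -> block_group T.
Proof.
move=> redT s t t' [sts tst] [st's t'st'].
have mulL u v : s * v * s = s -> u * s * (v * s) = u * s.
  by move=> svs; rewrite -smulA (smulA s) svs.
have mulR u v : s * u * s = s -> s * u * (s * v) = s * v.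
  by move=> sus; rewrite smulA sus.
have eqL : t * s = t' * s.
  by apply: (reduced_fix_or_swap (z := t * s) redT); left; rewrite !mulL.
have eqR : s * t = s * t'.
  by apply: (reduced_fix_or_swap (z := s * t) redT); right; rewrite !mulR.
(* t = tst = t'st = t'st' = t'. *)
by rewrite -tst eqL -smulA eqR smulA.
Qed.

End ReducedBlockGroup.

Section GroupPairs.
Variable gT : finGroupType.
Local Open Scope group_scope.

(** A strictly increasing series would give ['Z_n(G)] more than n elements for every n. *)
Lemma ucn_stationary (G : {group gT}) : exists n, 'Z_n.+1(G) = 'Z_n(G).
Proof.
apply: contrapT => /forallNP neZ.
have lt_n n : n < #|'Z_n(G)|.
  elim: n => [|n IHn]; first exact: cardG_gt0.
  apply: leq_ltn_trans IHn (proper_card _).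
  by rewrite properEneq eq_sym ucn_subS andbT; apply/eqP/neZ.
by have := lt_n #|G|; rewrite ltnNge subset_leq_card ?ucn_sub.
Qed.

Lemma not_ucn_commg (G : {group gT}) n x :
  x \in G -> x \notin 'Z_n.+1(G) ->
  exists2 y, y \in G & [~ x, y] \notin 'Z_n(G).
Proof.
move=> Gx notZx; apply/exists_inP; apply: contraNT notZx => /exists_inPn Zxy.
rewrite ucnSnR inE Gx gen_subG; apply/subsetP=> _ /imset2P[_ y /set1P-> Gy ->].
by rewrite -[_ \in _]negbK Zxy.
Qed.

Lemma nonnilpotent_pair_step :
  ~~ nilpotent [set: gT] ->
  exists (z : gT * gT -> gT) (p : gT * gT),
    forall k, let q := iter k (pair_step mulg z) p in q.1 != q.2.
Proof.
move=> non_nil; have [n ZE] := ucn_stationary [set: gT].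
pose Z := 'Z_n([set: gT]).
pose away (p : gT * gT) := p.1 * p.2^-1 \notin Z.
pose step (w : gT) := pair_step (@mulg gT) (fun=> w).
(* The default [1] is never taken at a pair that is [away]: [away_z] shows that a suitable letter
   exists there. *)
pose z p := odflt 1 [pick w | away (step w p)].
have away_z p : away p -> away (pair_step mulg z p).
  move=> away_p; rewrite -[pair_step _ _ _]/(step (z p) p) /z.
  case: pickP => [//|none].
  have [||w _] := @not_ucn_commg [set: gT] n (p.1 * p.2^-1)^-1.
  - by rewrite inE.
  - by rewrite ZE groupV.
  (* This letter makes [p.2 * z] equal to [w^-1]; with a = [p.1 * p.2^-1] the new ratio is a w^-1
     a^-1 w. *)
  have := none (p.2^-1 * w^-1); rewrite /away /step /pair_step /= => /negbT.
  rewrite negbK => Zpw; case/negP; suff <- : p.1 * (p.2^-1 * w^-1) * p.2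
    * (p.2 * (p.2^-1 * w^-1) * p.1)^-1 = [~ (p.1 * p.2^-1)^-1, w] by [].
  by rewrite commgEl conjgE !invMg !invgK !mulgA mulgK.
have [a notZa] : exists a, a \notin Z.
  have: ~~ ([set: gT] \subset Z).
    apply: contra non_nil => sGZ; apply/ucnP; exists n.
    by apply/eqP; rewrite eqEsubset ucn_sub.
  by case/subsetPn => a _ notZa; exists a.
exists z, (a, 1) => k /=.
have: away (iter k (pair_step mulg z) (a, 1)).
  by elim: k => [|k IHk]; [rewrite /away /= invg1 mulg1 | apply: away_z].
by apply: contraNneq => ->; rewrite mulgV group1.
Qed.

End GroupPairs.

Lemma reduced_subgroup_nilpotent (T : finSemigroupType) (H : subgroup T) :
  reduced T -> nilpotent [set: subgroup_type H].
Proof.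
move=> redT; apply: contraT => /nonnilpotent_pair_step[z [p neq]].
pose h (u : subgroup_type H) : T := sval u.
pose g (x : T) : subgroup_type H := insubd (sgt_one H) x.
have hK u : g (h u) = u by apply: valKd.
(* Outside the subgroup [g] takes the value [sgt_one H]; the iteration from [h p.1] and [h p.2]
   stays inside. *)
pose zT (r : T * T) := h (z (g r.1, g r.2)).
have [k] := redT zT (h p.1, h p.2).
have := @iter_pair_step_morph _ _ (@sgt_mul _ H) _ h z zT.
rewrite /zT => -> //=; last by move=> x y; rewrite !hK.
rewrite -surjective_pairing => /val_inj eq_q.
by have := neq k; rewrite /= eq_q eqxx.
Qed.

Theorem theorem3p5 (S : finSemigroupType) :
  BGnil (quotient_semigroup (eta_star_congruence S)).
Proof.
have redT := @quotient_eta_star_reduced S.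
split=> [|H]; first exact: reduced_block_group.
exact: reduced_subgroup_nilpotent.
Qed.
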